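(* Let $\{x,x_1\}$ be a Mannheim $D$-pair of type 1 in Minkowski 3-space $E_1^3$ ($x$ a Mannheim $D$-curve and $x_1$ a Mannheim partner $D$-curve of $x$), with $x(s)$ lying on the oriented surface $S$, $x_1(s_1)$ lying on the oriented surface $S_1$, and $x=x_1+\lambda n_1$ at corresponding points, where $\lambda$ is a nonzero constant. Let $\theta$ be the angle between the tangent vectors $T$ and $T_1$ at corresponding points. Then the geodesic torsions $\tau_g$ of $x$ and $\tau_{g_1}$ of $x_1$ satisfy $$\text{(i)}\quad \tau_{g_1}=-\tau_g\left(\frac{ds}{ds_1}\right)^2,\qquad\qquad \text{(ii)}\quad \tau_g\tau_{g_1}=-\frac{\sinh^2\theta}{\lambda^2}.$$ Consequently, $x_1$ is a principal line ($\tau_{g_1}=0$) whenever $x$ is a principal line ($\tau_g=0$).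
   Context: $E_1^3$ is $\mathbb{R}^3$ with the metric $\langle u,v\rangle=-u_1v_1+u_2v_2+u_3v_3$ and the Lorentzian vector product $u\times v=(u_2v_3-u_3v_2,\;u_1v_3-u_3v_1,\;u_2v_1-u_1v_2)$. All curves and surfaces are smooth. A surface is timelike (spacelike) if its normal vector is spacelike (timelike). Type 1 means: $S$ is a spacelike surface and $x(s)$ is a spacelike curve on it; $S_1$ is a timelike surface and $x_1(s_1)$ is a spacelike curve on it; $s$ and $s_1$ are arc-length parameters. Darboux frames. $\{T,g,n\}$ is the Darboux frame of $x$: $T$ is the unit tangent, $n$ the unit normal of $S$, $g=n\times T$; here $\langle T,T\rangle=\langle g,g\rangle=1$, $\langle n,n\rangle=-1$. $\{T_1,g_1,n_1\}$ is the Darboux frame of $x_1$ on $S_1$: $T_1$ is the unit tangent, $n_1$ the unit normal of $S_1$, $g_1=n_1\times T_1$; here $\langle T_1,T_1\rangle=1$, $\langle g_1,g_1\rangle=-1$, $\langle n_1,n_1\rangle=1$. Geodesic torsions. In this statement the geodesic torsions are given by $$\tau_g=\left\langle \frac{dx}{ds},\,n\times\frac{dn}{ds}\right\rangle,\qquad \tau_{g_1}=\left\langle \frac{dx_1}{ds_1},\,n_1\times\frac{dn_1}{ds_1}\right\rangle .$$ Mannheim $D$-pair. $\{x,x_1\}$ is a Mannheim $D$-pair if there is a smooth regular correspondence $s=s(s_1)$ between the points of the curves such that at corresponding points the frame vector $g$ of $x$ coincides with the frame vector $n_1$ of $x_1$, i.e. $g=n_1$ and $x(s(s_1))=x_1(s_1)+\lambda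 n_1(s_1)$ with $\lambda$ a nonzero constant. Angle. $\theta$ is the real number with $T=\cosh\theta\,T_1+\sinh\theta\,g_1$ and $n=\sinh\theta\,T_1+\cosh\theta\,g_1$ at corresponding points. *)

(* Defs.v *)
From HB Require Import structures.
From mathcomp Require Import all_boot all_order all_algebra.
From mathcomp Require Import all_classical all_reals all_analysis.

Set Implicit Arguments.
Unset Strict Implicit.
Unset Printing Implicit Defensive.

Import Order.TTheory GRing.Theory Num.Theory.
Import numFieldNormedType.Exports.

Local Open Scope classical_set_scope.
Local Open Scope ring_scope.

(* In E_1^3, the coordinates u_1, u_2, u_3 are [u 0 0], [u 0 1], [u 0 2]. *)
Definition lprod (R : realType) (u v : 'rV[R]_3) : R :=
  - (u 0 0 * v 0 0) + u 0 1 * v 0 1 + u 0 2 * v 0 2.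

Definition lcross (R : realType) (u v : 'rV[R]_3) : 'rV[R]_3 :=
  \row_(i < 3) [:: u 0 1 * v 0 2 - u 0 2 * v 0 1;
                   u 0 0 * v 0 2 - u 0 2 * v 0 0;
                   u 0 1 * v 0 0 - u 0 0 * v 0 1]`_i.

Definition lnorm (R : realType) (u : 'rV[R]_3) : R := Num.sqrt `|lprod u u|.

Definition spacelike (R : realType) (u : 'rV[R]_3) : Prop :=
  0 < lprod u u \/ u = 0.

Definition timelike (R : realType) (u : 'rV[R]_3) : Prop := lprod u u < 0.

Definition cosh (R : realType) (t : R) : R := (expR t + expR (- t)) / 2.
Definition sinh (R : realType) (t : R) : R := (expR t - expR (- t)) / 2.

(* [Ck k U f]: [f] is of class C^k on [U]; meaningful for [U] open, so that the
   directional derivatives on [U] do not depend on the values of [f] outside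
   [U]. *)
Fixpoint Ck (R : realType) (V W : normedModType R) (k : nat) (U : set V)
    (f : V -> W) : Prop :=
  if k is k'.+1 then
    (forall p, U p -> differentiable f p) /\
    (forall v : V, Ck k' U (fun p => 'D_v f p))
  else forall p, U p -> {for p, continuous f}.

Definition smooth (R : realType) (V W : normedModType R) (U : set V)
    (f : V -> W) : Prop :=
  forall k, Ck k U f.

(* A map defined on an arbitrary subset [A] is smooth when, around each point
   of [A], it is the restriction of a smooth map on an open set. *)
Definition smooth_on_subset (R : realType) (V W : normedModType R) (A : set V)
    (f : V -> W) : Prop :=
  forall p, A p -> exists (O : set V) (F : V -> W),
    [/\ open O, O p, smooth O F & forall q, (O `&` A) q -> f q = F q].

(* [X : U -> S `&` O] is a regular local parametrization: a smooth
   homeomorphism of an open set of the plane onto a relatively open subset of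
   [S], with injective differential. *)
Record local_parametrization (R : realType) (S O : set 'rV[R]_3)
    (U : set 'rV[R]_2) (X : 'rV[R]_2 -> 'rV[R]_3) : Prop := {
  param_open_target : open O ;
  param_open_source : open U ;
  param_smooth : smooth U X ;
  param_image : X @` U = S `&` O ;
  param_inverse : exists Y : 'rV[R]_3 -> 'rV[R]_2,
    {within S `&` O, continuous Y} /\ (forall q, U q -> Y (X q) = q) ;
  param_immersion : forall q, U q -> injective ('d X q)
}.

Definition regular_surface (R : realType) (S : set 'rV[R]_3) : Prop :=
  forall p, S p -> exists O U X, O p /\ local_parametrization S O U X.

(* A tangent vector is the velocity of a smooth curve drawn on the surface. *)
Definition tangent_vector (R : realType) (S : set 'rV[R]_3) (p w : 'rV[R]_3) :
    Prop :=
  exists (e : R) (a : R -> 'rV[R]_3),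
    [/\ 0 < e, smooth `]-e, e[%classic a,
        forall t, -e < t < e -> S (a t),
        a 0 = p & derive1 a 0 = w].

(* [N] is an orientation of [S]: a smooth unit normal field, where normality
   and length are those of the Lorentzian metric.  Only the values of [N] on
   [S] matter. *)
Record unit_normal_field (R : realType) (S : set 'rV[R]_3)
    (N : 'rV[R]_3 -> 'rV[R]_3) : Prop := {
  normal_smooth : smooth_on_subset S N ;
  normal_unit : forall p, S p -> lnorm (N p) = 1 ;
  normal_orthogonal : forall p w, S p -> tangent_vector S p w ->
    lprod (N p) w = 0
}.

Definition oriented_surface (R : realType) (S : set 'rV[R]_3)
    (N : 'rV[R]_3 -> 'rV[R]_3) : Prop :=
  regular_surface S /\ unit_normal_field S N.

Definition spacelike_surface (R : realType) (S : set 'rV[R]_3)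
    (N : 'rV[R]_3 -> 'rV[R]_3) : Prop :=
  oriented_surface S N /\ forall p, S p -> timelike (N p).

Definition timelike_surface (R : realType) (S : set 'rV[R]_3)
    (N : 'rV[R]_3 -> 'rV[R]_3) : Prop :=
  oriented_surface S N /\ forall p, S p -> spacelike (N p).

Record arc_length_spacelike_curve (R : realType) (I : set R)
    (x : R -> 'rV[R]_3) : Prop := {
  curve_open : open I ;
  curve_interval : is_interval I ;
  curve_smooth : smooth I x ;
  curve_spacelike : forall s, I s -> spacelike (derive1 x s) ;
  curve_arc_length : forall s, I s -> lnorm (derive1 x s) = 1
}.

Definition on_surface (R : realType) (I : set R) (x : R -> 'rV[R]_3)
    (S : set 'rV[R]_3) : Prop :=
  forall s, I s -> S (x s).

(* The Darboux frame {T, g, n} of a curve [x], parametrized by arc length, on a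
   surface with unit normal field [N]. *)
Definition frame_T (R : realType) (x : R -> 'rV[R]_3) : R -> 'rV[R]_3 :=
  derive1 x.

Definition frame_n (R : realType) (N : 'rV[R]_3 -> 'rV[R]_3)
    (x : R -> 'rV[R]_3) : R -> 'rV[R]_3 :=
  fun s => N (x s).

Definition frame_g (R : realType) (N : 'rV[R]_3 -> 'rV[R]_3)
    (x : R -> 'rV[R]_3) : R -> 'rV[R]_3 :=
  fun s => lcross (frame_n N x s) (frame_T x s).

Definition geodesic_torsion (R : realType) (N : 'rV[R]_3 -> 'rV[R]_3)
    (x : R -> 'rV[R]_3) (s : R) : R :=
  lprod (derive1 x s) (lcross (frame_n N x s) (derive1 (frame_n N x) s)).

Definition principal_line (R : realType) (N : 'rV[R]_3 -> 'rV[R]_3)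
    (I : set R) (x : R -> 'rV[R]_3) : Prop :=
  forall s, I s -> geodesic_torsion N x s = 0.

Record type1 (R : realType)
    (S : set 'rV[R]_3) (N : 'rV[R]_3 -> 'rV[R]_3) (I : set R)
    (x : R -> 'rV[R]_3)
    (S1 : set 'rV[R]_3) (N1 : 'rV[R]_3 -> 'rV[R]_3) (I1 : set R)
    (x1 : R -> 'rV[R]_3) : Prop := {
  type1_S : spacelike_surface S N ;
  type1_x : arc_length_spacelike_curve I x ;
  type1_x_on_S : on_surface I x S ;
  type1_S1 : timelike_surface S1 N1 ;
  type1_x1 : arc_length_spacelike_curve I1 x1 ;
  type1_x1_on_S1 : on_surface I1 x1 S1
}.

(* [sigma] is the correspondence s = s(s_1). *)
Record mannheim_D_pair (R : realType)
    (N : 'rV[R]_3 -> 'rV[R]_3) (I : set R) (x : R -> 'rV[R]_3)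
    (N1 : 'rV[R]_3 -> 'rV[R]_3) (I1 : set R) (x1 : R -> 'rV[R]_3)
    (sigma : R -> R) (lambda : R) : Prop := {
  mannheim_bij : set_bij I1 I sigma ;
  mannheim_smooth : smooth I1 sigma ;
  mannheim_regular : forall s1, I1 s1 -> derive1 sigma s1 != 0 ;
  mannheim_lambda : lambda != 0 ;
  mannheim_frame : forall s1, I1 s1 ->
    frame_g N x (sigma s1) = frame_n N1 x1 s1 ;
  mannheim_offset : forall s1, I1 s1 ->
    x (sigma s1) = x1 s1 + lambda *: frame_n N1 x1 s1
}.

(* [theta s1] is the angle at the point of parameter [s1] of [x1] and the
   corresponding point of [x]; it may vary along the curves. *)
Definition mannheim_angle (R : realType)
    (N : 'rV[R]_3 -> 'rV[R]_3) (x : R -> 'rV[R]_3)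
    (N1 : 'rV[R]_3 -> 'rV[R]_3) (I1 : set R) (x1 : R -> 'rV[R]_3)
    (sigma theta : R -> R) : Prop :=
  forall s1, I1 s1 ->
    frame_T x (sigma s1) = cosh (theta s1) *: frame_T x1 s1
                           + sinh (theta s1) *: frame_g N1 x1 s1 /\
    frame_n N x (sigma s1) = sinh (theta s1) *: frame_T x1 s1
                             + cosh (theta s1) *: frame_g N1 x1 s1.

(* Main.v *)
(* Differentiating x(s(s_1)) = x_1 + lambda n_1 gives
   lambda n_1' = s' T - T_1.  Substituting this and
   T = cosh(theta) T_1 + sinh(theta) g_1 in tau_{g_1} = <T_1, n_1 x n_1'> leaves
   lambda tau_{g_1} = s' sinh(theta).  On the other hand tau_g = <g', n>, and
   g = n_1 gives s' g' = n_1', so pairing the first identity with n yields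
   lambda s' tau_g = - <T_1, n> = - sinh(theta).  Both torsion formulas follow
   from these two identities. *)

Require Import Defs.
From mathcomp Require Import all_boot all_order all_algebra.
From mathcomp Require Import all_classical all_reals all_analysis.
From mathcomp Require Import ring.
Import Order.TTheory GRing.Theory Num.Theory.
Import numFieldNormedType.Exports.
Local Open Scope classical_set_scope.
Local Open Scope ring_scope.

Lemma lprodBl (R : realType) (u v w : 'rV[R]_3) :
  lprod (u - v) w = lprod u w - lprod v w.
Proof. by rewrite /lprod !mxE; ring. Qed.

Lemma lprodDl (R : realType) (u v w : 'rV[R]_3) :
  lprod (u + v) w = lprod u w + lprod v w.
Proof. by rewrite /lprod !mxE; ring. Qed.

Lemma lprodDr (R : realType) (u v w : 'rV[R]_3) :
  lprod u (v + w) = lprod u v + lprod u w.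
Proof. by rewrite /lprod !mxE; ring. Qed.

Lemma lprodZl (R : realType) (a : R) (u v : 'rV[R]_3) :
  lprod (a *: u) v = a * lprod u v.
Proof. by rewrite /lprod !mxE; ring. Qed.

Lemma lprodZr (R : realType) (a : R) (u v : 'rV[R]_3) :
  lprod u (a *: v) = a * lprod u v.
Proof. by rewrite /lprod !mxE; ring. Qed.

Lemma lcrossDr (R : realType) (u v w : 'rV[R]_3) :
  lcross u (v + w) = lcross u v + lcross u w.
Proof. by apply/rowP => -[[|[|[|//]]] i3]; rewrite !mxE /=; ring. Qed.

Lemma lcrossZr (R : realType) (a : R) (u v : 'rV[R]_3) :
  lcross u (a *: v) = a *: lcross u v.
Proof. by apply/rowP => -[[|[|[|//]]] i3]; rewrite !mxE /=; ring. Qed.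

Lemma lprod_lcrossr (R : realType) (u v : 'rV[R]_3) :
  lprod u (lcross v u) = 0.
Proof. by rewrite /lprod /lcross !mxE /=; ring. Qed.

Lemma lprod_lcrossl (R : realType) (u v : 'rV[R]_3) :
  lprod (lcross u v) u = 0.
Proof. by rewrite /lprod /lcross !mxE /=; ring. Qed.

(** Both sides are minus a determinant, of [u, v, w] and of [v, w, u], and a cyclic permutation of
    the rows preserves it. *)
Lemma lprod_lcross_cycle (R : realType) (u v w : 'rV[R]_3) :
  lprod u (lcross v w) = lprod (lcross w u) v.
Proof. by rewrite /lprod /lcross !mxE /=; ring. Qed.

(** Lagrange's identity, with the sign opposite to the Euclidean one. It evaluates the pairing of
    T_1 with n_1 x g_1, since g_1 = n_1 x T_1. *)
Lemma lprod_lcross_lcross (R : realType) (u v : 'rV[R]_3) :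
  lprod u (lcross v (lcross v u)) = lprod v v * lprod u u - lprod v u ^+ 2.
Proof. by rewrite /lprod /lcross !mxE /=; ring. Qed.

Lemma lprod_spacelike_unit (R : realType) (u : 'rV[R]_3) :
  spacelike u -> lnorm u = 1 -> lprod u u = 1.
Proof.
rewrite /lnorm => -[u_gt0|->].
  rewrite gtr0_norm// => u1.
  by rewrite -[LHS]sqr_sqrtr ?ltW// u1 expr1n.
(* [spacelike] admits the zero vector; the norm hypothesis excludes it, as it would give 0 = 1. *)
rewrite /lprod !mxE !mulr0 oppr0 !addr0 normr0 sqrtr0 => /esym/eqP.
by rewrite oner_eq0.
Qed.

Lemma is_derive_rowP (R : realType) (n : nat) (f : R -> 'rV[R]_n) (t : R)
    (df : 'rV[R]_n) :
  is_derive t (1 : R) f df <->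
  forall i, is_derive t (1 : R) (fun s => f s 0 i) (df 0 i).
Proof.
split=> [[fd <-] i|fd].
  split; first by move/derivable_mxP: fd; apply.
  by rewrite derive_mx// mxE.
have fdr : derivable f t 1.
  by apply/derivable_mxP => i j; rewrite ord1; case: (fd j).
split=> //; rewrite derive_mx//; apply/rowP => i; rewrite mxE.
by case: (fd i).
Qed.

Lemma is_derive_lcross (R : realType) (f g : R -> 'rV[R]_3) (t : R)
    (df dg : 'rV[R]_3) :
  is_derive t (1 : R) f df -> is_derive t (1 : R) g dg ->
  is_derive t (1 : R) (fun s => lcross (f s) (g s))
    (lcross df (g t) + lcross (f t) dg).
Proof.
move=> /is_derive_rowP fd /is_derive_rowP gd; apply/is_derive_rowP.
(* Each coordinate of the Lorentzian product is such a minor for a suitable ordered pair of indices,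
   so one use of the product rule serves all three. *)
have minor i j : is_derive t (1 : R)
    (fun s => f s 0 i * g s 0 j - f s 0 j * g s 0 i)
    (f t 0 i * dg 0 j + g t 0 j * df 0 i
     - (f t 0 j * dg 0 i + g t 0 i * df 0 j)).
  by apply: is_deriveB; apply: is_deriveM.
move=> -[[|[|[|//]]] i3].
- rewrite (_ : (fun s => _) = fun s => f s 0 1 * g s 0 2 - f s 0 2 * g s 0 1).
    by apply: is_derive_eq; rewrite !mxE /=; ring.
  by apply/funext => s; rewrite mxE.
- rewrite (_ : (fun s => _) = fun s => f s 0 0 * g s 0 2 - f s 0 2 * g s 0 0).
    by apply: is_derive_eq; rewrite !mxE /=; ring.
  by apply/funext => s; rewrite mxE.
- rewrite (_ : (fun s => _) = fun s => f s 0 1 * g s 0 0 - f s 0 0 * g s 0 1).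
    by apply: is_derive_eq; rewrite !mxE /=; ring.
  by apply/funext => s; rewrite mxE.
Qed.

Lemma is_derive_reparam (R : realType) (V : normedModType R) (f : R -> V)
    (h : R -> R) (t dh : R) (df : V) :
  is_derive t (1 : R) h dh -> is_derive (h t) (1 : R) f df ->
  is_derive t (1 : R) (f \o h) (dh *: df).
Proof.
move=> [hd <-] [fd <-].
have hD : differentiable h t by apply/derivable1_diffP.
have fD : differentiable f (h t) by apply/derivable1_diffP.
split; first by apply/derivable1_diffP; exact: differentiable_comp.
rewrite deriveE; last exact: differentiable_comp.
rewrite diff_comp//=.
(* In one real variable the differential multiplies the increment by the derivative; here the
   increment is ['d h t 1], the derivative of [h]. *)
have /(congr1 (@^~ ('d h t 1))) /= -> := deriv1E fd.
by rewrite -deriveE// derive1E.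
Qed.

Lemma smooth_is_derive1 (R : realType) (V : normedModType R) (U : set R)
    (f : R -> V) (t : R) :
  smooth U f -> U t -> is_derive t (1 : R) f (derive1 f t).
Proof.
move=> /(_ 1%N)[fd _] Ut; rewrite derive1E; apply: DeriveDef => //.
by apply/derivable1_diffP; exact: fd.
Qed.

Lemma smooth_derive1 (R : realType) (V : normedModType R) (U : set R)
    (f : R -> V) :
  smooth U f -> smooth U (derive1 f).
Proof.
move=> fs k; have [_ /(_ 1)] := fs k.+1.
by congr Ck; apply/funext => t; rewrite derive1E.
Qed.

Lemma Ck_subset (R : realType) (V W : normedModType R) (k : nat)
    (A B : set V) (f : V -> W) :
  A `<=` B -> Ck k B f -> Ck k A f.
Proof.
move=> AB; elim: k f => [|k IHk] f /=; first by move=> fc p /AB/fc.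
by move=> [fd fk]; split => [p /AB/fd//|v]; exact/IHk.
Qed.

(** Directional derivatives commute with translations, which carries the induction on [k]. *)
Lemma Ck_shift (R : realType) (V W : normedModType R) (k : nat)
    (U : set V) (f : V -> W) (c : V) :
  Ck k U f -> Ck k (shift c @^-1` U) (f \o shift c).
Proof.
elim: k f => [|k IHk] f /=.
  move=> fc p Up; apply: continuous_comp; last exact: fc.
  by apply: (@continuousD _ _ _ id (cst c)); [exact: cvg_id|exact: cvg_cst].
move=> [fd fk]; split => [p Up|v].
  by apply: differentiable_comp; [exact: differentiableD|exact: fd].
rewrite (_ : (fun p => _) = (fun p => 'D_v f p) \o shift c).
  exact/IHk.
apply/funext => p; rewrite /= /derive/=.
by under [in RHS]eq_fun do rewrite addrA.
Qed.

(** [tangent_vector] wants a curve through the point at parameter 0, so [x] is translated by [s] and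
    restricted to an interval that stays in [I]. *)
Lemma velocity_tangent_vector (R : realType) (S : set 'rV[R]_3) (I : set R)
    (x : R -> 'rV[R]_3) (s : R) :
  open I -> smooth I x -> on_surface I x S -> I s ->
  tangent_vector S (x s) (derive1 x s).
Proof.
move=> oI xs xS Is.
have /nbhs_ballP[e /= e0 eI] : nbhs s I by exact: open_nbhs_nbhs.
have shiftI t : -e < t < e -> I (t + s).
  move=> te; apply: eI; rewrite /ball/= opprD addrCA subrr addr0 normrN.
  by rewrite ltr_norml.
exists e, (x \o shift s); split; first exact: e0.
- move=> k; apply: (@Ck_subset _ _ _ _ _ (shift s @^-1` I)); last first.
    exact/Ck_shift/xs.
  by move=> t; rewrite /= in_itv/=; exact: shiftI.
- by move=> t te; apply/xS/shiftI.
- by rewrite /= add0r.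
- by rewrite /derive1 /=; under eq_fun do rewrite addr0 add0r.
Qed.

(** [N] is only known to agree on [S] with a smooth map [F] defined around [x s]. As the curve stays
    on [S], its normal equals [F \o x] near [s] and is derivable there. *)
Lemma is_derive_frame_n (R : realType) (S : set 'rV[R]_3)
    (N : 'rV[R]_3 -> 'rV[R]_3) (I : set R) (x : R -> 'rV[R]_3) (s : R) :
  unit_normal_field S N -> open I -> smooth I x -> on_surface I x S -> I s ->
  is_derive s (1 : R) (frame_n N x) (derive1 (frame_n N x) s).
Proof.
move=> [Ns _ _] oI xs xS Is.
have [Ox [F [oO Oxs Fs NF]]] := Ns _ (xS _ Is).
have xd : differentiable x s by case: (xs 1%N) => /(_ _ Is).
have Fd : differentiable F (x s) by case: (Fs 1%N) => /(_ _ Oxs).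
have Nx : {near s, frame_n N x =1 F \o x}.
  have xO : \forall t \near s, Ox (x t).
    by apply: (differentiable_continuous xd); exact: open_nbhs_nbhs.
  have xI : \forall t \near s, I t by exact: open_nbhs_nbhs.
  near=> t; rewrite /frame_n; apply: NF; split; first by near: t.
  by apply: xS; near: t.
rewrite derive1E; apply: DeriveDef => //.
apply: (near_eq_derivable _ _ (f := F \o x)) => //.
- by apply: filterS Nx => t.
- exact/derivable1_diffP/differentiable_comp.
Unshelve. all: by end_near. Qed.

Lemma torsion_relations (F : fieldType) (lambda d sh tau tau1 : F) :
  lambda != 0 -> lambda * tau1 = d * sh -> lambda * (d * tau) = - sh ->
  tau1 = - tau * d ^+ 2 /\ tau * tau1 = - (sh ^+ 2 / lambda ^+ 2).
Proof.
move=> lambda0 tau1E tauE; split.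
  by apply: (mulfI lambda0); rewrite tau1E -[sh]opprK -tauE; ring.
(* Multiply the first identity by [lambda * tau], then use the second to turn [lambda * tau * d]
   into [- sh]. *)
have -> : sh ^+ 2 = - (lambda ^+ 2 * (tau * tau1)).
  transitivity (- (lambda * tau * (lambda * tau1))); last by ring.
  by rewrite tau1E -[sh]opprK -tauE; ring.
by field.
Qed.

Theorem corollary4p2 (R : realType)
    (S S1 : set 'rV[R]_3) (N N1 : 'rV[R]_3 -> 'rV[R]_3)
    (I I1 : set R) (x x1 : R -> 'rV[R]_3)
    (sigma theta : R -> R) (lambda : R)
    (Htype1 : type1 S N I x S1 N1 I1 x1)
    (Hpair : mannheim_D_pair N I x N1 I1 x1 sigma lambda)
    (Hangle : mannheim_angle N x N1 I1 x1 sigma theta) :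
  (forall s1 : R, I1 s1 ->
     geodesic_torsion N1 x1 s1
       = - geodesic_torsion N x (sigma s1) * (derive1 sigma s1) ^+ 2 /\
     geodesic_torsion N x (sigma s1) * geodesic_torsion N1 x1 s1
       = - (sinh (theta s1) ^+ 2 / lambda ^+ 2)) /\
  (principal_line N I x -> principal_line N1 I1 x1).
Proof.
have [[[_ SN] _] xarc xS [[_ S1N1] N1space] x1arc x1S1] := Htype1.
have [Iopen _ xsm _ _] := xarc.
have [I1open _ x1sm x1space x1unit] := x1arc.
have [[sigmaI _ _] sigmasm _ lambda0 gn1 offset] := Hpair.
suff key s1 : I1 s1 ->
    lambda * geodesic_torsion N1 x1 s1 = derive1 sigma s1 * sinh (theta s1) /\
    lambda * (derive1 sigma s1 * geodesic_torsion N x (sigma s1))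
      = - sinh (theta s1).
  have torsions s1 : I1 s1 -> geodesic_torsion N1 x1 s1
         = - geodesic_torsion N x (sigma s1) * (derive1 sigma s1) ^+ 2 /\
       geodesic_torsion N x (sigma s1) * geodesic_torsion N1 x1 s1
         = - (sinh (theta s1) ^+ 2 / lambda ^+ 2).
    by move=> /key[]; exact: torsion_relations lambda0.
  split=> // xpl s1 I1s1; have [-> _] := torsions _ I1s1.
  by rewrite xpl ?oppr0 ?mul0r//; exact: sigmaI.
move=> I1s1; have Is : I (sigma s1) by exact: sigmaI.
have [TE nE] := Hangle _ I1s1.
have TT1 : lprod (frame_T x1 s1) (frame_T x1 s1) = 1.
  by apply: lprod_spacelike_unit; [exact: x1space|exact: x1unit].
have nn1 : lprod (frame_n N1 x1 s1) (frame_n N1 x1 s1) = 1.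
  apply: lprod_spacelike_unit; first exact/N1space/x1S1.
  exact: (normal_unit S1N1 (x1S1 _ I1s1)).
have nT1 : lprod (frame_n N1 x1 s1) (frame_T x1 s1) = 0.
  apply: (normal_orthogonal S1N1 (x1S1 _ I1s1)).
  exact: velocity_tangent_vector x1S1 I1s1.
have xT : lprod (frame_T x (sigma s1)) (frame_n N x (sigma s1)) = 0.
  have nT : lprod (frame_n N x (sigma s1)) (frame_T x (sigma s1)) = 0.
    apply: (normal_orthogonal SN (xS _ Is)).
    exact: velocity_tangent_vector xS Is.
  by rewrite -nT /lprod; ring.
have Dsigma := smooth_is_derive1 _ _ _ _ _ sigmasm I1s1.
have DT := smooth_is_derive1 _ _ _ _ _ xsm Is.
have Dn1 := is_derive_frame_n _ _ _ _ _ _ S1N1 I1open x1sm x1S1 I1s1.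
have Dn := is_derive_frame_n _ _ _ _ _ _ SN Iopen xsm xS Is.
have DT' := smooth_is_derive1 _ _ _ _ _ (smooth_derive1 _ _ _ _ xsm) Is.
(* The relations g = n_1 and x = x_1 + lambda n_1 hold only on [I1]; since it is open they hold near
   [s1], so both may be differentiated there. *)
have nearI1 : \forall t \near s1, I1 t by exact: open_nbhs_nbhs.
have offset' : lambda *: derive1 (frame_n N1 x1) s1
    = derive1 sigma s1 *: frame_T x (sigma s1) - frame_T x1 s1.
  have [_ <-] := is_derive_reparam _ _ _ _ _ _ _ Dsigma DT.
  have [_ D2] := is_deriveD (smooth_is_derive1 _ _ _ _ _ x1sm I1s1)
                            (is_deriveZ lambda Dn1).
  rewrite (@near_eq_derive _ _ _ _ (x1 + lambda \*: frame_n N1 x1))//.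
    by rewrite D2 addrC addKr.
  by apply: filterS nearI1 => t /offset.
have Dg := is_derive_lcross _ _ _ _ _ _ Dn DT'.
have gn1' : derive1 (frame_n N1 x1) s1 = derive1 sigma s1 *:
   (lcross (derive1 (frame_n N x) (sigma s1)) (frame_T x (sigma s1))
    + lcross (frame_n N x (sigma s1)) (derive1 (derive1 x) (sigma s1))).
  have [_ <-] := is_derive_reparam _ _ _ _ _ _ _ Dsigma Dg.
  rewrite derive1E; apply: near_eq_derive => //.
  by apply: filterS nearI1 => t /gn1 <-.
split.
  rewrite /geodesic_torsion -lprodZr -lcrossZr offset' TE.
  rewrite -scaleN1r !lcrossDr !lcrossZr !lcrossDr !lcrossZr.
  (* The T_1 terms vanish because n_1 x T_1 is orthogonal to T_1. The g_1 term leaves the factor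
     given by Lagrange's identity, which is 1 as T_1 and n_1 are unit and orthogonal. *)
  rewrite !(lprodDr, lprodZr) lprod_lcrossr lprod_lcross_lcross.
  by rewrite TT1 nn1 nT1; ring.
(* In g' = n' x T + n x T' the second term is orthogonal to n, and the cyclic rule identifies the
   pairing of n' x T with n as the geodesic torsion of [x]. *)
have -> : derive1 sigma s1 * geodesic_torsion N x (sigma s1)
    = lprod (derive1 (frame_n N1 x1) s1) (frame_n N x (sigma s1)).
  rewrite gn1' lprodZl /geodesic_torsion lprod_lcross_cycle.
  by rewrite lprodDl lprod_lcrossl addr0.
(* T is orthogonal to n, so only minus the pairing of T_1 with n remains; it is [- sinh (theta s1)]
   because T_1 is unit and orthogonal to g_1. *)
rewrite -lprodZl offset' lprodBl lprodZl xT nE lprodDr !lprodZr TT1.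
by rewrite /frame_g lprod_lcrossr; ring.
Qed.
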